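(* Let $\mathbb{F}$ be a linearly ordered field. Let $f:\mathbb{F}^{n}\to\mathbb{F}$ be a quadratic function and let $P\subseteq\mathbb{F}^{n}$ be a non-empty polyhedron. If $f$ is bounded from below on $P$, then $f$ attains its minimum on $P$, i.e. there exists $x^{*}\in P$ with $f(x^{*})\le f(x)$ for all $x\in P$.
   Context: A linearly ordered field is a field with a total order compatible with addition and multiplication; it is not assumed to be real closed, Archimedean or complete. A quadratic function is a function of the form $f(x)=x^{T}Qx+c^{T}x+\gamma$ with $Q\in\mathbb{F}^{n\times n}$ symmetric, $c\in\mathbb{F}^{n}$, $\gamma\in\mathbb{F}$ (no definiteness is assumed, and $Q=0$ is allowed). A polyhedron is a set $P=\{x\in\mathbb{F}^{n}:Ax\le b\}$ with $A\in\mathbb{F}^{m\times n}$, $b\in\mathbb{F}^{m}$ (finitely many inequalities, componentwise order), where each row of $A$ is non-zero. ''Bounded from below on $P$'' means that there is $\nu\in\mathbb{F}$ with $f(x)\ge\nu$ for all $x\in P$. *)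

(* Defs.v *)
From mathcomp Require Import all_boot all_order all_algebra.

Set Implicit Arguments.
Unset Strict Implicit.
Unset Printing Implicit Defensive.

Import Order.TTheory GRing.Theory Num.Theory.
Local Open Scope ring_scope.

(* A linearly ordered field is a realFieldType: a field with a compatible
   total order. The norm of that structure is determined by the order, being
   the absolute value; no real-closed, Archimedean or completeness axiom is
   included. *)

Definition quadratic_function (F : realFieldType) (n : nat)
    (f : 'cV[F]_n -> F) : Prop :=
  exists (Q : 'M[F]_n) (c : 'cV[F]_n) (gamma : F),
    Q^T = Q /\
    forall x, f x = (x^T *m Q *m x) 0 0 + (c^T *m x) 0 0 + gamma.

(* The number m of inequalities may be 0, so the whole space is a polyhedron. *)
Definition polyhedron (F : realFieldType) (n : nat)
    (P : {pred 'cV[F]_n}) : Prop :=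
  exists (m : nat) (A : 'M[F]_(m, n)) (b : 'cV[F]_m),
    (forall i, row i A != 0) /\
    forall x, x \in P <-> forall i, (A *m x) i 0 <= b i 0.

Definition bounded_below_on (F : realFieldType) (n : nat)
    (f : 'cV[F]_n -> F) (P : {pred 'cV[F]_n}) : Prop :=
  exists nu : F, forall x, x \in P -> nu <= f x.

(* Main.v *)
(** A point [x] of [P] can be pushed, without increasing [f], onto a facet of
    [P], unless [f] has an unconstrained minimiser inside [P]: if [Q] takes a
    negative value at some [d], move along [d] or [- d]; if [Q] is positive
    semidefinite and [2 Q x + c = 0] has no solution, move along some [d] with
    [Q d = 0] and [c^T d < 0]; otherwise move towards a solution of
    [2 Q x + c = 0].  In the first two cases [f] is unbounded below along the
    ray, which therefore leaves [P].  Each facet lies in a hyperplane, where [f]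
    attains its minimum by induction on the dimension, and the least of these
    finitely many minima is the minimum on [P]. *)

Require Import Defs.
From mathcomp Require Import all_boot all_order all_algebra.
From mathcomp Require Import ring lra.
From Stdlib Require Import Classical_Prop.

Set Implicit Arguments.
Unset Strict Implicit.
Unset Printing Implicit Defensive.

Import Order.TTheory GRing.Theory Num.Theory.
Local Open Scope ring_scope.

(** * Finite unions and polyhedra along a ray *)

Definition polyhedral (F : realFieldType) m n (A : 'M[F]_(m, n))
    (b : 'cV[F]_m) : {pred 'cV[F]_n} :=
  [pred x | [forall i, (A *m x) i 0 <= b i 0]].

Definition attains_min_on (F : realFieldType) T (f : T -> F)
    (P : {pred T}) : Prop :=
  exists xs, xs \in P /\ forall x, x \in P -> f xs <= f x.

Lemma attains_min_on_bigcup (F : realFieldType) (T : Type) (I : finType)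
    (f : T -> F) (S : I -> {pred T}) :
  (forall i x, x \in S i -> attains_min_on f (S i)) ->
  (exists i x, x \in S i) ->
  exists i y, y \in S i /\ forall j x, x \in S j -> f y <= f x.
Proof.
move=> minS [i0 [x0 Sx0]].
have /fin_all_exists [y minimal_y] i :
    exists y, forall x, x \in S i -> y \in S i /\ f y <= f x.
  have [[x Sx]|S0] := classic (exists x, x \in S i).
    by have [y [Sy miny]] := minS i x Sx; exists y => z /miny.
  (* Here [S i] is empty and [x0] is only a dummy value. *)
  by exists x0 => x Sx; case: S0; exists x.
have Si0 : y i0 \in S i0 by have [] := minimal_y i0 x0 Sx0.
case: (arg_minP (fun i => f (y i)) (Si0 : (fun i => y i \in S i) i0)).
move=> i Si mini; exists i, (y i); split=> // j x Sx.
have [Sj lejx] := minimal_y j x Sx.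
exact: le_trans (mini j Sj) lejx.
Qed.

(** Ratio test: among the constraints violated at time [t], the one that becomes tight first, at
    time [r i], gives the exit point. *)
Lemma polyhedral_exit (F : realFieldType) m n (A : 'M[F]_(m, n))
    (b : 'cV[F]_m) (x d : 'cV[F]_n) (t : F) :
  x \in polyhedral A b -> 0 <= t -> x + t *: d \notin polyhedral A b ->
  exists s i, [/\ 0 <= s <= t, x + s *: d \in polyhedral A b,
    row i A != 0 & (A *m (x + s *: d)) i 0 = b i 0].
Proof.
move=> /forallP Px t0 /forallPn [i0 Pi0].
have E s i : (A *m (x + s *: d)) i 0 = (A *m x) i 0 + s * (A *m d) i 0.
  by rewrite mulmxDr -scalemxAr !mxE.
pose V i := ~~ ((A *m (x + t *: d)) i 0 <= b i 0).
pose r i := (b i 0 - (A *m x) i 0) / (A *m d) i 0.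
have Vpos i : V i -> 0 < (A *m d) i 0.
  rewrite /V E -ltNge => Vi; rewrite ltNge; apply/negP => d0.
  have := Px i; nra.
case: (arg_minP r (Pi0 : V i0)) => i Vi mini.
have di := Vpos i Vi.
have rE : r i * (A *m d) i 0 = b i 0 - (A *m x) i 0 by rewrite divfK ?gt_eqF.
have r0 : 0 <= r i by rewrite divr_ge0 ?subr_ge0 ?Px // ltW.
have rt : r i <= t.
  rewrite ler_pdivrMr //; move: Vi; rewrite /V E -ltNge; lra.
exists (r i), i; split.
- by rewrite r0.
- apply/forallP => j; rewrite E.
  have [Vj|] := boolP (V j).
    have := mini j Vj; rewrite {2}/r ler_pdivlMr ?Vpos //; lra.
  (* A constraint satisfied at times [0] and [t] holds in between, being affine in time. *)
  rewrite /V negbK E => Vj; have Pj : (A *m x) j 0 <= b j 0 by exact: Px.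
  have [dj|/ltW dj] := leP 0 ((A *m d) j 0).
    by apply: le_trans Vj; rewrite lerD2l ler_wpM2r.
  by rewrite -[leRHS]addr0 lerD // mulr_ge0_le0.
- apply: contraL di => /eqP Ai0.
  have -> : (A *m d) i 0 = row i (A *m d) 0 0 by rewrite [RHS]mxE.
  by rewrite row_mul Ai0 mul0mx mxE ltxx.
- by rewrite E rE; ring.
Qed.

(** * Quadratic functions along lines *)

Section Quadratic.
Variables (F : realFieldType) (n : nat).
Variables (Q : 'M[F]_n) (c : 'cV[F]_n) (gamma : F).
Hypothesis symQ : Q^T = Q.

Definition qform (d : 'cV[F]_n) : F := (d^T *m Q *m d) 0 0.

Definition qfun (x : 'cV[F]_n) : F := qform x + (c^T *m x) 0 0 + gamma.

(** The directional derivative of [qfun]: the gradient [2 Q x + c] paired with [d]. *)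
Definition slope (x d : 'cV[F]_n) : F :=
  2 * (x^T *m Q *m d) 0 0 + (c^T *m d) 0 0.

Lemma bilinear_sym (x y : 'cV[F]_n) :
  (x^T *m Q *m y) 0 0 = (y^T *m Q *m x) 0 0.
Proof.
have -> : x^T *m Q *m y = (y^T *m Q *m x)^T.
  by rewrite !trmx_mul trmxK symQ mulmxA.
by rewrite mxE.
Qed.

Lemma qfun_line (x d : 'cV[F]_n) t :
  qfun (x + t *: d) = qfun x + t * slope x d + t ^+ 2 * qform d.
Proof.
have E : (x + t *: d)^T = x^T + t *: d^T by rewrite linearD linearZ.
rewrite /qfun /slope /qform E !mulmxDl !mulmxDr -!scalemxAl -!scalemxAr.
have mxD (M N : 'M[F]_1) : (M + N) 0 0 = M 0 0 + N 0 0 by rewrite mxE.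
have mxZ a (M : 'M[F]_1) : (a *: M) 0 0 = a * M 0 0 by rewrite mxE.
rewrite !(mxD, mxZ) (bilinear_sym d x); ring.
Qed.

Lemma qformN d : qform (- d) = qform d.
Proof.
have E : (- d)^T = - d^T by rewrite linearN.
by rewrite /qform E mulmxN !mulNmx opprK.
Qed.

Lemma slopeN x d : slope x (- d) = - slope x d.
Proof.
have mxN (M : 'M[F]_1) : (- M) 0 0 = - M 0 0 by rewrite mxE.
by rewrite /slope !mulmxN !mxN mulrN opprD.
Qed.

(** Fredholm alternative for [2 Q x + c = 0]: either [c^T] lies in the row space of [Q], or some [d]
    in the kernel of [Q] is not orthogonal to [c]; then [slope x d] is [c^T d] for every [x]. *)
Lemma stationary_or_descent :
  (exists x0, forall d, slope x0 d = 0) \/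
  (exists d, qform d = 0 /\ forall x, slope x d < 0).
Proof.
have [/submxP [D cD]|] := boolP (c^T <= Q)%MS.
  left; exists (- 2^-1 *: D^T) => d.
  have E : (- 2^-1 *: D^T)^T = - 2^-1 *: D by rewrite linearZ /= trmxK.
  rewrite /slope cD E -!scalemxAl [X in 2 * X]mxE.
  by rewrite mulrA mulrN mulfV ?pnatr_eq0 // mulN1r addNr.
rewrite submxE; move: (cokermx Q) (mulmx_coker Q) => K QK /eqP cK0; right.
have [j cj0] : exists j, (c^T *m K) 0 j != 0.
  apply/existsP; apply: contra_notT cK0 => /existsPn c0.
  by apply/rowP => j; rewrite !mxE; have := c0 j; rewrite negbK mxE => /eqP.
(* This factor makes the slope minus the square of [(c^T *m K) 0 j]. *)
pose d := - (c^T *m K) 0 j *: col j K.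
have Qd : Q *m d = 0.
  by rewrite -scalemxAr colE mulmxA QK mul0mx scaler0.
exists d; split=> [|x]; first by rewrite /qform -mulmxA Qd mulmx0 mxE.
rewrite /slope -mulmxA Qd mulmx0 -scalemxAr colE mulmxA -colE.
have scale_col (v : 'rV[F]_n) : (- v 0 j *: col j v) 0 0 = - v 0 j * v 0 j.
  by rewrite !mxE.
by rewrite scale_col [X in 2 * X]mxE mulr0 add0r mulNr oppr_lt0 -expr2 exprn_even_gt0.
Qed.

(** * Pushing points onto facets *)

Section Descent.
Variables (m : nat) (A : 'M[F]_(m, n)) (b : 'cV[F]_m).

(** The row is required to be non-zero because restricting to a hyperplane can create zero rows,
    which cut out no hyperplane. *)
Definition facet i : {pred 'cV[F]_n} :=
  [pred x | [&& row i A != 0, x \in polyhedral A b &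
                (A *m x) i 0 == b i 0]].

Lemma descent_to_facet x d t :
  x \in polyhedral A b -> 0 <= t -> x + t *: d \notin polyhedral A b ->
  (forall s, 0 <= s <= t -> qfun (x + s *: d) <= qfun x) ->
  exists i y, y \in facet i /\ qfun y <= qfun x.
Proof.
move=> Px t0 Pt desc.
have [s [i [st Ps Ai tight]]] := polyhedral_exit Px t0 Pt.
exists i, (x + s *: d); split; last exact: desc.
by rewrite inE Ai Ps tight eqxx.
Qed.

Lemma ray_to_facet nu x d :
  (forall y, y \in polyhedral A b -> nu <= qfun y) ->
  x \in polyhedral A b ->
  qform d <= 0 -> slope x d <= 0 -> slope x d + qform d < 0 ->
  exists i y, y \in facet i /\ qfun y <= qfun x.
Proof.
move=> hb Px q0 g0 gq; have nux := hb x Px.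
(* As [t >= 1] and [qform d <= 0], the value at time [t] is at most
   [qfun x + t * (slope x d + qform d)], which equals [nu + slope x d + qform d < nu]. *)
pose t := 1 + (nu - qfun x) / (slope x d + qform d).
have tE : t * (slope x d + qform d) = slope x d + qform d + (nu - qfun x).
  by rewrite mulrDl mul1r divfK // lt_eqF.
have t1 : 1 <= t by rewrite lerDl mulr_le0 ?invr_le0 ?subr_le0 // ltW.
have t0 : 0 <= t by lra.
apply: (descent_to_facet Px t0 (d := d)).
  have tq : t * (t - 1) * qform d <= 0.
    by rewrite mulr_ge0_le0 // mulr_ge0 ?subr_ge0.
  by apply/negP => /hb; rewrite qfun_line; lra.
move=> s /andP [s0 _]; rewrite qfun_line -addrA gerDl.
by rewrite -[leRHS]addr0 lerD // mulr_ge0_le0 ?exprn_ge0.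
Qed.

Lemma minimum_or_facet nu :
  (forall y, y \in polyhedral A b -> nu <= qfun y) ->
  attains_min_on qfun (polyhedral A b) \/
  forall x, x \in polyhedral A b ->
    exists i y, y \in facet i /\ qfun y <= qfun x.
Proof.
move=> hb.
have [[d qd]|psd] := classic (exists d, qform d < 0).
  right=> x Px; have [g0|g0] := leP (slope x d) 0.
    by apply: (ray_to_facet hb Px (d := d)); lra.
  by apply: (ray_to_facet hb Px (d := - d)); rewrite ?slopeN ?qformN; lra.
have {psd} q0 d : 0 <= qform d.
  by rewrite leNgt; apply/negP => qd; apply: psd; exists d.
have [[x0 stat]|[d [qd gd]]] := stationary_or_descent; last first.
  right=> x Px; have gx := gd x.
  by apply: (ray_to_facet hb Px (d := d)); lra.
have fE x : qfun x = qfun x0 + qform (x - x0).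
  have := qfun_line x0 (x - x0) 1.
  by rewrite stat scale1r addrC subrK => ->; ring.
have [Px0|Px0] := boolP (x0 \in polyhedral A b).
  by left; exists x0; split=> // x _; rewrite (fE x) lerDl.
right=> x Px; apply: (descent_to_facet Px ler01 (d := x0 - x)).
  by rewrite scale1r addrC subrK.
(* Compare the expansions of [qfun] at [x] and at [x0]. The change along the segment is then
   [s * (s - 2) * qform (x0 - x)], nonpositive for [s] in [[0, 1]]. *)
have slopeE : slope x (x0 - x) = - 2 * qform (x0 - x).
  have := qfun_line x (x0 - x) 1; rewrite scale1r (addrC x) subrK expr1n.
  have := fE x; rewrite -(opprB x0 x) qformN; lra.
move=> s /andP [s0 s1]; rewrite qfun_line slopeE -addrA gerDl.
have -> : s * (- 2 * qform (x0 - x)) + s ^+ 2 * qform (x0 - x)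
    = s * (s - 2) * qform (x0 - x) by ring.
by rewrite mulr_le0_ge0 // mulr_ge0_le0 //; lra.
Qed.

End Descent.
End Quadratic.

(** * Restriction to hyperplanes and induction on the dimension *)

Lemma qfun_affine (F : realFieldType) n k (Q : 'M[F]_n) c gamma (y : 'cV[F]_n)
    (N : 'M[F]_(n, k)) (z : 'cV[F]_k) : Q^T = Q ->
  qfun Q c gamma (y + N *m z) =
  qfun (N^T *m Q *m N) (N^T *m (2 *: (Q *m y) + c)) (qfun Q c gamma y) z.
Proof.
move=> symQ; have := qfun_line c gamma symQ y (N *m z) 1.
rewrite scale1r => ->; rewrite {2}/qfun /slope.
have -> : qform Q (N *m z) = qform (N^T *m Q *m N) z.
  by rewrite /qform trmx_mul !mulmxA.
have -> : (N^T *m (2 *: (Q *m y) + c))^T *m z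
    = 2 *: (y^T *m Q *m (N *m z)) + c^T *m (N *m z).
  by rewrite trmx_mul trmxK linearD linearZ /= trmx_mul symQ !mulmxDl
             -!scalemxAl !mulmxA.
rewrite [X in _ = _ + X + _]mxE [X in _ = _ + (X + _) + _]mxE; ring.
Qed.

Lemma polyhedral_affine (F : realFieldType) m n k (A : 'M[F]_(m, n)) b
    (y : 'cV[F]_n) (N : 'M[F]_(n, k)) (z : 'cV[F]_k) :
  (y + N *m z \in polyhedral A b)
  = (z \in polyhedral (A *m N) (b - A *m y)).
Proof.
apply: eq_forallb => i.
by rewrite mulmxDr mulmxA [X in X <= _]mxE [X in _ = (_ <= X)]mxE
           [X in _ = (_ <= _ + X)]mxE lerBrDl.
Qed.

(** The columns of [N] form a basis of the kernel of [a], whose dimension is [n - \rank a]. *)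
Lemma hyperplane_param (F : fieldType) n (a : 'rV[F]_n) : a != 0 ->
  exists k (N : 'M[F]_(n, k)), [/\ (k < n)%N, a *m N = 0 &
    forall d : 'cV[F]_n, a *m d = 0 -> exists z, d = N *m z].
Proof.
move=> a0; pose K := kermx a^T.
exists (\rank K), (row_base K)^T; split.
- have r0 : (0 < \rank a)%N by rewrite lt0n mxrank_eq0.
  by rewrite mxrank_ker mxrank_tr ltn_subrL r0 (leq_trans r0 (rank_leq_col a)).
- apply: trmx_inj; rewrite trmx_mul trmxK trmx0; apply/sub_kermxP.
  by rewrite eq_row_base.
- move=> d ad; have : (d^T <= row_base K)%MS.
    by rewrite eq_row_base; apply/sub_kermxP; rewrite -trmx_mul ad trmx0.
  by move=> /submxP [D dD]; exists D^T; rewrite -trmx_mul -dD trmxK.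
Qed.

Lemma qfun_attains_min (F : realFieldType) n (Q : 'M[F]_n) c gamma m
    (A : 'M[F]_(m, n)) b nu x0 :
  Q^T = Q -> x0 \in polyhedral A b ->
  (forall x, x \in polyhedral A b -> nu <= qfun Q c gamma x) ->
  attains_min_on (qfun Q c gamma) (polyhedral A b).
Proof.
(* Dimension 0 needs no separate case: every row is zero there, so no facet has a point. *)
elim/ltn_ind: n => n IH in Q c gamma m A b nu x0 * => symQ Px0 hb.
have [//|to_facet] := minimum_or_facet symQ hb.
have [||i [y [/and3P [_ Py _] miny]]] :=
    @attains_min_on_bigcup F _ _ (qfun Q c gamma) (facet A b).
- move=> i y /and3P [Ai Py /eqP tight].
  have [k [N [ltkn AN paramN]]] := hyperplane_param Ai.
  have facetN z : z \in polyhedral (A *m N) (b - A *m y) ->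
      y + N *m z \in facet A b i.
    rewrite -polyhedral_affine => Pz; apply/and3P; split=> //.
    have -> : (A *m (y + N *m z)) i 0 = (A *m y) i 0 + (row i A *m N *m z) 0 0.
      by rewrite mulmxDr mxE mulmxA -!row_mul [X in _ = _ + X]mxE.
    by rewrite AN mul0mx [X in _ + X]mxE addr0 tight.
  (* With [y] as origin, the feasible point is [0], and [nu] still bounds the restricted
     function. *)
  have [|||z [Pz minz]] := IH k ltkn (N^T *m Q *m N)
      (N^T *m (2 *: (Q *m y) + c)) (qfun Q c gamma y) m (A *m N)
      (b - A *m y) nu 0.
  + by rewrite !trmx_mul trmxK symQ mulmxA.
  + by rewrite -polyhedral_affine mulmx0 addr0.
  + by move=> z Pz; rewrite -qfun_affine //; apply: hb; rewrite polyhedral_affine.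
  exists (y + N *m z); split; first exact: facetN.
  move=> x /and3P [_ Px /eqP tightx].
  (* Constraint [i] is tight at both [x] and [y], so [row i A] kills their difference. *)
  have [|w dw] := paramN (x - y).
    apply/matrixP => p q; rewrite !ord1 -row_mul mxE mulmxBr !mxE.
    by move: tight tightx; rewrite !mxE => -> ->; rewrite subrr.
  have xE : x = y + N *m w by rewrite -dw addrC subrK.
  rewrite xE !qfun_affine //; apply: minz.
  by rewrite -polyhedral_affine -xE.
- by have [i [y [Sy _]]] := to_facet x0 Px0; exists i, y.
exists y; split=> // x /to_facet [j [z [Sz lezx]]].
exact: le_trans (miny j z Sz) lezx.
Qed.

Theorem theorem4p1 (F : realFieldType) (n : nat)
    (f : 'cV[F]_n -> F) (P : {pred 'cV[F]_n})
    (hf : quadratic_function f)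
    (hP : polyhedron P)
    (hP0 : exists x, x \in P)
    (hb : bounded_below_on f P) :
  exists xs, xs \in P /\ forall x, x \in P -> f xs <= f x.
Proof.
have [Q [c [gamma [symQ fE]]]] := hf.
have [m [A [b [_ PE]]]] := hP.
have [x0 Px0] := hP0; have [nu hnu] := hb.
have memP x : (x \in P) <-> (x \in polyhedral A b).
  by split=> [/PE Ax|/forallP /PE //]; apply/forallP.
have [||xs [/memP Pxs minxs]] :=
    @qfun_attains_min F n Q c gamma m A b nu x0 symQ.
- exact/memP.
- by move=> x /memP /hnu; rewrite fE.
by exists xs; split=> // x /memP /minxs; rewrite !fE.
Qed.
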